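(* Let $\mathcal{G}$ be a connected groupoid, $x\in\mathcal{G}_0$, $\tau(x)=\{\tau_y\}_{y\in\mathcal{G}_0}$ a transversal for $x$, $A$ a ring, $\gamma=(I,\gamma_{\tau(x)},\gamma_{(x)})$ an object of $\mathsf{D}_{\mathcal{G},\tau(x)}(A)$, and $\theta=\mathtt{Ext}(\gamma)$. Suppose that: (C1) $I_{\tau_y^{-1}}=I_x$ and $I_{\tau_y}=I_y$ for all $y\in\mathcal{G}_0$; (C2) $I_x$ is a unital ring and the partial group action $\gamma_{(x)}$ of $\mathcal{G}(x)$ on $I_x$ admits a globalization $(J_x,\tilde\gamma_{(x)})$, with $\tilde\gamma_{(x)}=\{\tilde\gamma_h\}_{h\in\mathcal{G}(x)}$ a global action of $\mathcal{G}(x)$ on $J_x$; (C3) there are a ring $B$, a family of ideals $\{J_y\}_{y\in\mathcal{G}_0}$ of $B$ (with $J_x$ the ring in (C2)) and a family of ring isomorphisms $\{\tilde\gamma_{\tau_y}:J_x\to J_y\}_{y\in\mathcal{G}_0}$ such that $I_y$ is an ideal of $J_y$ and $\tilde\gamma_{\tau_y}|_{I_x}=\gamma_{\tau_y}$ for all $y\in\mathcal{G}_0$. Then the groupoid action $\beta=(C_g,\beta_g)_{g\in\mathcal{G}}$ of $\mathcal{G}$ on $B$ given by $$C_g=J_{t(g)},\qquad \beta_g=\tilde\gamma_{\tau_{t(g)}}\tilde\gamma_{g_x}\tilde\gamma_{\tau_{s(g)}}^{-1}:J_{s(g)}\to J_{t(g)},$$ is the globalization of $\theta$ (that is, $(B,\beta)$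 is a globalization of $\theta$).
   Context: Rings are associative and not necessarily unital; ideals are two-sided. A groupoid $\mathcal{G}$ is a small category in which every morphism is an isomorphism; $g\in\mathcal{G}$ means $g$ is a morphism; $\mathcal{G}_0$ is the set of objects, each object being identified with its identity morphism; $s(g),t(g)$ are source and target; composition is written right to left, so $gh$ is defined iff $s(g)=t(h)$. $\mathcal{G}(x,y)=\{g\in\mathcal{G}: s(g)=x,\ t(g)=y\}$ and $\mathcal{G}(x)=\mathcal{G}(x,x)$. $\mathcal{G}$ is connected if $\mathcal{G}(x,y)\neq\emptyset$ for all $x,y\in\mathcal{G}_0$. A partial action of $\mathcal{G}$ on a ring $A$ is a family $\alpha=(A_g,\alpha_g)_{g\in\mathcal{G}}$ such that: (P1) for each $g$, $A_{t(g)}$ is an ideal of $A$, $A_g$ is an ideal of $A_{t(g)}$ and $\alpha_g:A_{g^{-1}}\to A_g$ is a ring isomorphism; (P2) $\alpha_x=\mathrm{id}_{A_x}$ for $x\in\mathcal{G}_0$; (P3) $\alpha_h^{-1}(A_{g^{-1}}\cap A_h)\subseteq A_{(gh)^{-1}}$ whenever $s(g)=t(h)$; (P4) $\alpha_g(\alpha_h(a))=\alpha_{gh}(a)$ for all $a\in\alpha_h^{-1}(A_{g^{-1}}\cap A_h)$ whenever $s(g)=t(h)$. The partial action is global if $\alpha_g\alpha_h=\alpha_{gh}$ whenever $s(g)=t(h)$ (equivalently $A_g=A_{t(g)}$ for all $g$). A partial action of a group $H$ on a ring $I$ is a partial action of $H$ viewed as a one-object groupoid, the ideal attached to the identity of $H$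 being $I$ itself. A globalization of $\alpha=(A_g,\alpha_g)_{g\in\mathcal{G}}$ is a pair $(B,\beta)$, $B$ a ring and $\beta=(B_g,\beta_g)_{g\in\mathcal{G}}$ a global action of $\mathcal{G}$ on $B$, such that: (G1) $A_x$ is an ideal of $B_x$ for each $x\in\mathcal{G}_0$; (G2) $A_g=A_{t(g)}\cap\beta_g(A_{s(g)})$ for all $g$; (G3) $\beta_g(a)=\alpha_g(a)$ for all $a\in A_{g^{-1}}$; (G4) $B_g=\sum_{t(h)=t(g)}\beta_h(A_{s(h)})$ for all $g$. Globalizations are unique up to isomorphism. For partial group actions the definition is applied to the one-object groupoid. A transversal for $x\in\mathcal{G}_0$ is a family $\tau(x)=\{\tau_y\}_{y\in\mathcal{G}_0}$ with $\tau_y\in\mathcal{G}(x,y)$ and $\tau_x=x$. For $g\in\mathcal{G}$ put $g_x:=\tau_{t(g)}^{-1}g\tau_{s(g)}\in\mathcal{G}(x)$. Composition of partial bijections $f:X\to Y$, $f':X'\to Y'$ of a set is $f'f:f^{-1}(X'\cap Y)\to f'(X'\cap Y)$. An object of $\mathsf{D}_{\mathcal{G},\tau(x)}(A)$ is a triple $(I,\gamma_{\tau(x)},\gamma_{(x)})$ where: $I=\{I_y\}_{y\in\mathcal{G}_0}$ is a family of ideals of $A$; $\gamma_{\tau(x)}=\{\gamma_{\tau_y}:I_{\tau_y^{-1}}\to I_{\tau_y}\}_{y\in\mathcal{G}_0}$ is a family of ring isomorphisms with $I_{\tau_y^{-1}}$ an ideal of $I_x$, $I_{\tau_y}$ an ideal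 of $I_y$, and $\gamma_{\tau_x}=\gamma_x=\mathrm{id}_{I_x}$; $\gamma_{(x)}=(I_h,\gamma_h)_{h\in\mathcal{G}(x)}$ is a partial action of the group $\mathcal{G}(x)$ on $I_x$; and for all $g\in\mathcal{G}$ the set $\gamma_{\tau_{t(g)}}\big(I_{\tau_{t(g)}^{-1}}\cap\gamma_{g_x}(I_{\tau_{s(g)}^{-1}}\cap I_{g_x^{-1}})\big)$ is an ideal of $I_{t(g)}$. $\mathtt{Ext}(\gamma)$ is the partial action $\theta=(B_g,\theta_g)_{g\in\mathcal{G}}$ of $\mathcal{G}$ on $A$ with $\theta_y=\mathrm{id}_{I_y}$ for $y\in\mathcal{G}_0$, $\theta_g=\gamma_{\tau_{t(g)}}\gamma_{g_x}\gamma_{\tau_{s(g)}}^{-1}$ (composition of partial bijections) for $g\notin\mathcal{G}_0$, and $B_g$ the range of $\theta_g$. *)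

(* Defs.v *)
From HB Require Import structures.
From mathcomp Require Import all_boot all_order all_algebra.
From mathcomp Require Import boolp classical_sets functions.

Set Implicit Arguments.
Unset Strict Implicit.
Unset Printing Implicit Defensive.

Import GRing.Theory.
Local Open Scope ring_scope.
Local Open Scope classical_set_scope.

(* Associative rings, not necessarily unital; the ring types of ssralg all
   have a multiplicative identity. *)
HB.mixin Record Zmodule_isRng R of GRing.Zmodule R := {
  rmul : R -> R -> R;
  rmulA : associative rmul;
  rmulDl : left_distributive rmul +%R;
  rmulDr : right_distributive rmul +%R
}.

#[short(type="rngType")]
HB.structure Definition Rng := {R of Zmodule_isRng R & GRing.Zmodule R}.

Notation "a ** b" := (rmul a b) (at level 40, left associativity) : ring_scope.

Definition is_subring (A : rngType) (R : set A) : Prop :=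
  [/\ R 0,
      forall a b, R a -> R b -> R (a - b) &
      forall a b, R a -> R b -> R (a ** b)].

(* Rings such as I_x and J_x are subrings of an ambient rngType, so the ring R
   in which the ideal lives is a parameter; a rngType A is [set: A]. *)
Definition is_ideal (A : rngType) (R I : set A) : Prop :=
  [/\ I `<=` R,
      I 0,
      forall a b, I a -> I b -> I (a - b) &
      forall r a, R r -> I a -> I (r ** a) /\ I (a ** r)].

Definition is_unital (A : rngType) (R : set A) : Prop :=
  exists2 e, R e & forall a, R a -> e ** a = a /\ a ** e = a.

Definition is_ring_hom (A B : rngType) (X : set A) (f : A -> B) : Prop :=
  forall a b, X a -> X b -> f (a + b) = f a + f b /\ f (a ** b) = f a ** f b.

Definition is_embedding (A B : rngType) (X : set A) (f : A -> B) : Prop :=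
  is_ring_hom X f /\ set_inj X f.

(* The sum of a family of subsets: all finite sums of elements taken from its
   members. *)
Definition set_sum (A : rngType) (K : Type) (F : K -> set A) : set A :=
  [set a | exists (n : nat) (k : 'I_n -> K) (c : 'I_n -> A),
     (forall i, F (k i) (c i)) /\ a = \sum_(i < n) c i].

(* A bijection from the subset pdom f onto the subset pcod f; the values of
   the underlying total function outside pdom f are irrelevant. *)
Record pbij (A B : rngType) : Type := PBij {
  pdom : set A;
  pcod : set B;
  pfun :> A -> B;
  pfun_bij : set_bij pdom pcod pfun
}.

Definition pbij_eq (A B : rngType) (f g : pbij A B) : Prop :=
  [/\ pdom f = pdom g, pcod f = pcod g & forall a, pdom f a -> f a = g a].

Definition is_ring_iso (A B : rngType) (f : pbij A B) : Prop :=
  is_ring_hom (pdom f) f.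

Lemma pbij_id_bij (A : rngType) (X : set A) : set_bij X X idfun.
Proof. by split=> // a Xa; exists a. Qed.

Definition pbij_id (A : rngType) (X : set A) : pbij A A := PBij (pbij_id_bij X).

Definition pbij_inv (A B : rngType) (f : pbij A B) : pbij B A :=
  PBij (bijpinv_bij (fun=> 0) (pfun_bij f)).

Lemma pbij_comp_bij (A B C : rngType) (f' : pbij B C) (f : pbij A B) :
  set_bij (pbij_inv f @` (pdom f' `&` pcod f)) (f' @` (pdom f' `&` pcod f))
          (f' \o f).
Proof.
have [ff fi fs] := pfun_bij f; have [f'f f'i f's] := pfun_bij f'.
have fK : forall b, pcod f b -> f (pbij_inv f b) = b.
  by move=> b fb; apply: (surjpK _ fs); rewrite inE.
split.
- by move=> _ [b [db cb] <-]; exists b => //=; rewrite fK.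
- move=> _ _ /set_mem[b [db cb] <-] /set_mem[c [dc cc] <-] /=.
  by rewrite !fK // => /f'i ->; rewrite ?inE.
- move=> _ [b [db cb] <-]; exists (pbij_inv f b); last by rewrite /= fK.
  by exists b.
Qed.

Definition pbij_comp (A B C : rngType) (f' : pbij B C) (f : pbij A B)
    : pbij A C :=
  PBij (pbij_comp_bij f' f).

Record groupoid : Type := Groupoid {
  ob :> Type;
  hom : ob -> ob -> Type;
  gid : forall y, hom y y;
  gcomp : forall y z w, hom z w -> hom y z -> hom y w;
  ginv : forall y z, hom y z -> hom z y;
  gcompA : forall y z w v (f : hom w v) (g : hom z w) (h : hom y z),
    gcomp f (gcomp g h) = gcomp (gcomp f g) h;
  gcomp1 : forall y z (g : hom y z), gcomp (gid z) g = g;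
  gcompr1 : forall y z (g : hom y z), gcomp g (gid y) = g;
  gcompV : forall y z (g : hom y z), gcomp (ginv g) g = gid y;
  gcomprV : forall y z (g : hom y z), gcomp g (ginv g) = gid z
}.

Definition connected (G : groupoid) : Prop :=
  forall y z : G, inhabited (hom y z).

(* For g : hom y z this forces y = z and says that g lies in G_0. *)
Inductive is_identity (G : groupoid) : forall y z : G, hom y z -> Prop :=
  IsIdentity (y : G) : is_identity (gid y).

(* The group G(x), as a one-object groupoid. *)
Definition isotropy (G : groupoid) (x : G) : groupoid :=
  @Groupoid unit (fun _ _ => hom x x) (fun _ => gid x)
    (fun _ _ _ g h => gcomp g h) (fun _ _ g => ginv g)
    (fun _ _ _ _ f g h => gcompA f g h)
    (fun _ _ g => gcomp1 g) (fun _ _ g => gcompr1 g)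
    (fun _ _ g => gcompV g) (fun _ _ g => gcomprV g).

Record transversal_for (G : groupoid) (x : G) : Type := Transversal {
  tr :> forall y : G, hom x y;
  tr_base : tr x = gid x
}.

Definition to_isotropy (G : groupoid) (x : G) (tau : transversal_for x)
    (y z : G) (g : hom y z) : hom x x :=
  gcomp (ginv (tau z)) (gcomp g (tau y)).

(* The data (A_g, alpha_g)_g, with hom y z = G(y,z): A_g is pcod (alpha_g), and
   for an object y the ideal A_y is A_g with g the identity of y. *)
Definition pfamily (G : groupoid) (A : rngType) : Type :=
  forall y z : G, hom y z -> pbij A A.

Definition carrier (G : groupoid) (A : rngType) (alpha : pfamily G A)
    (y z : G) (g : hom y z) : set A := pcod (alpha y z g).

Definition obcarrier (G : groupoid) (A : rngType) (alpha : pfamily G A)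
    (y : G) : set A := carrier alpha (gid y).

Record is_partial_action (G : groupoid) (A : rngType) (R : set A)
    (alpha : pfamily G A) : Prop := {
  pa_ring : is_subring R;
  pa_P1 : forall (y z : G) (g : hom y z),
    [/\ is_ideal R (obcarrier alpha z),
        is_ideal (obcarrier alpha z) (carrier alpha g),
        pdom (alpha y z g) = carrier alpha (ginv g) &
        is_ring_iso (alpha y z g)];
  pa_P2 : forall y : G,
    pbij_eq (alpha y y (gid y)) (pbij_id (obcarrier alpha y));
  pa_P3 : forall (y z w : G) (g : hom z w) (h : hom y z),
    pbij_inv (alpha y z h) @` (carrier alpha (ginv g) `&` carrier alpha h)
    `<=` carrier alpha (ginv (gcomp g h));
  pa_P4 : forall (y z w : G) (g : hom z w) (h : hom y z) (a : A),
    (pbij_inv (alpha y z h) @`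
       (carrier alpha (ginv g) `&` carrier alpha h)) a ->
    alpha z w g (alpha y z h a) = alpha y w (gcomp g h) a
}.

Record is_global_action (G : groupoid) (A : rngType) (R : set A)
    (alpha : pfamily G A) : Prop := {
  ga_partial : is_partial_action R alpha;
  ga_comp : forall (y z w : G) (g : hom z w) (h : hom y z),
    pbij_eq (pbij_comp (alpha z w g) (alpha y z h)) (alpha y w (gcomp g h))
}.

(* A and B are different types, so the inclusions of A_y in B_y are given by
   embeddings iota y; taking every iota y to be the restriction of one inclusion
   map recovers the set-theoretic definition. *)
Record is_globalization (G : groupoid) (A B : rngType)
    (R : set A) (alpha : pfamily G A) (S : set B) (beta : pfamily G B)
    (iota : G -> A -> B) : Prop := {
  gl_partial : is_partial_action R alpha;
  gl_global : is_global_action S beta;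
  gl_emb : forall y : G, is_embedding (obcarrier alpha y) (iota y);
  gl_G1 : forall y : G,
    is_ideal (obcarrier beta y) (iota y @` obcarrier alpha y);
  gl_G2 : forall (y z : G) (g : hom y z),
    iota z @` carrier alpha g =
    (iota z @` obcarrier alpha z) `&`
    (beta y z g @` (iota y @` obcarrier alpha y));
  gl_G3 : forall (y z : G) (g : hom y z) (a : A),
    carrier alpha (ginv g) a ->
    beta y z g (iota y a) = iota z (alpha y z g a);
  gl_G4 : forall (y z : G) (g : hom y z),
    carrier beta g =
    set_sum (fun h : {w : G & hom w z} =>
      beta (projT1 h) z (projT2 h) @`
        (iota (projT1 h) @` obcarrier alpha (projT1 h)))
}.

Definition isotropy_family (G : groupoid) (x : G) (A : rngType)
    (alpha : hom x x -> pbij A A) : pfamily (isotropy x) A :=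
  fun _ _ h => alpha h.

Definition is_partial_group_action (G : groupoid) (x : G) (A : rngType)
    (R : set A) (alpha : hom x x -> pbij A A) : Prop :=
  is_partial_action R (isotropy_family alpha) /\ pcod (alpha (gid x)) = R.

Record is_group_globalization (G : groupoid) (x : G) (A B : rngType)
    (R : set A) (alpha : hom x x -> pbij A A)
    (S : set B) (beta : hom x x -> pbij B B) (iota : A -> B) : Prop := {
  ggl_partial : is_partial_group_action R alpha;
  ggl_global : is_partial_group_action S beta;
  ggl_glob : is_globalization R (isotropy_family alpha)
               S (isotropy_family beta) (fun _ => iota)
}.

(* The objects (I, gamma_tau(x), gamma_(x)) of D_{G,tau(x)}(A), with
   I_{tau_y^-1} = pdom (d_tau y), I_{tau_y} = pcod (d_tau y),
   I_h = pcod (d_iso h). *)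
Record dobject (G : groupoid) (x : G) (tau : transversal_for x) (A : rngType)
    : Type := DObject {
  d_ideal : G -> set A;
  d_tau : G -> pbij A A;
  d_iso : hom x x -> pbij A A;
  d_idealP : forall y, is_ideal [set: A] (d_ideal y);
  d_tau_iso : forall y, is_ring_iso (d_tau y);
  d_tau_dom : forall y, is_ideal (d_ideal x) (pdom (d_tau y));
  d_tau_cod : forall y, is_ideal (d_ideal y) (pcod (d_tau y));
  d_tau_base : pbij_eq (d_tau x) (pbij_id (d_ideal x));
  d_isoP : is_partial_group_action (d_ideal x) d_iso;
  d_compat : forall (y z : G) (g : hom y z),
    let gx := to_isotropy tau g in
    is_ideal (d_ideal z)
      (d_tau z @` (pdom (d_tau z) `&`
         (d_iso gx @` (pdom (d_tau y) `&` pcod (d_iso (ginv gx))))))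
}.

Definition conj_family (G : groupoid) (x : G) (tau : transversal_for x)
    (A : rngType) (f : G -> pbij A A) (alpha : hom x x -> pbij A A)
    : pfamily G A :=
  fun y z g =>
    pbij_comp (f z) (pbij_comp (alpha (to_isotropy tau g)) (pbij_inv (f y))).

Definition Ext (G : groupoid) (x : G) (tau : transversal_for x) (A : rngType)
    (gamma : dobject tau A) : pfamily G A :=
  fun y z g =>
    if pselect (is_identity g) then pbij_id (d_ideal gamma y)
    else conj_family tau (d_tau gamma) (d_iso gamma) g.

(* Main.v *)
(* Under (C1) each θ_g is the transport of the group map γ_{g_x} along the ring
   isomorphisms γ_{τ_y} : I_x -> I_y, and β_g is the transport of γ~_{g_x} along
   γ~_{τ_y} : J_x -> J_y.  As g |-> g_x is a functor onto G(x), transport carries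
   the axioms of a partial (global) action of G(x) to those of G, and the
   globalization conditions for G are the images under γ~_{τ_z} of those for G(x),
   because γ~_{τ_y} extends γ_{τ_y}. *)

From mathcomp Require Import all_boot ssralg.
From mathcomp Require Import boolp classical_sets functions.
Require Import Defs.

Set Implicit Arguments.
Unset Strict Implicit.
Unset Printing Implicit Defensive.

Import GRing.Theory.
Local Open Scope ring_scope.
Local Open Scope classical_set_scope.

(** * Ideals, subrings and homomorphisms defined on subsets *)

Lemma is_idealD (A : rngType) (R I : set A) a b :
  is_ideal R I -> I a -> I b -> I (a + b).
Proof.
by case=> _ I0 IB _ Ia Ib; rewrite -[b]opprK -[- b]sub0r; apply: (IB) (IB _ _ I0 Ib).
Qed.

Lemma is_subring_ideal (A : rngType) (R : set A) : is_subring R -> is_ideal R R.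
Proof. by case=> R0 RB RM; split=> // r a Rr Ra; split; apply: RM. Qed.

Lemma is_subring_setT (A : rngType) : is_subring [set: A].
Proof. by []. Qed.

Lemma ring_hom0 (A B : rngType) (X : set A) (f : A -> B) :
  is_ring_hom X f -> X 0 -> f 0 = 0.
Proof.
by move=> fH X0; apply: (addrI (f 0)); rewrite -(fH 0 0 X0 X0).1 !addr0.
Qed.

Lemma ring_homB (A B : rngType) (X : set A) (f : A -> B) a b :
  is_subring X -> is_ring_hom X f -> X a -> X b -> f (a - b) = f a - f b.
Proof.
case=> _ XB _ fH Xa Xb; apply: (addIr (f b)).
by rewrite -(fH _ _ (XB _ _ Xa Xb) Xb).1 !subrK.
Qed.

Lemma ring_hom_sum (A B : rngType) (X : set A) (f : A -> B) n (c : 'I_n -> A) :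
  is_subring X -> is_ring_hom X f -> (forall i, X (c i)) ->
  f (\sum_(i < n) c i) = \sum_(i < n) f (c i).
Proof.
move=> Xr fH Xc; have [X0 _ _] := Xr.
(* The induction also carries membership of the partial sums in [X], because [f] is additive only
   there. *)
have [//] : X (\sum_(i < n) c i) /\ f (\sum_(i < n) c i) = \sum_(i < n) f (c i).
apply: (big_rec2 (fun u v => X u /\ f u = v)).
  by split=> //; apply: (ring_hom0 fH).
move=> i v u _ [Xu <-]; split; last by rewrite (fH _ _ (Xc i) Xu).1.
exact: (is_idealD (is_subring_ideal Xr)).
Qed.

Lemma is_ideal_image (A B : rngType) (X I : set A) (f : A -> B) :
  is_subring X -> is_ring_hom X f -> is_ideal X I ->
  is_ideal (f @` X) (f @` I).
Proof.
move=> Xr fH [IX I0 IB IM]; have [X0 _ _] := Xr; split.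
- exact: image_subset.
- by exists 0 => //; apply: (ring_hom0 fH).
- move=> _ _ [a Ia <-] [b Ib <-]; exists (a - b); first exact: IB.
  by apply: (ring_homB Xr fH); apply: IX.
- move=> _ _ [r Xr' <-] [a Ia <-]; have [Ira Iar] := IM r a Xr' Ia.
  by split; [exists (r ** a) | exists (a ** r)] => //;
    apply: (fH _ _ _ _).2 => //; apply: IX.
Qed.

(** * Calculus of partial bijections *)

Lemma pbij_inj (A B : rngType) (f : pbij A B) a b :
  pdom f a -> pdom f b -> f a = f b -> a = b.
Proof. by move=> fa fb; case: (pfun_bij f) => _ + _; apply; rewrite inE. Qed.

Lemma pbij_image (A B : rngType) (f : pbij A B) : f @` pdom f = pcod f.
Proof.
have [ff _ fs] := pfun_bij f; apply/seteqP; split=> [_ [a fa <-]|]; first exact: ff.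
exact: fs.
Qed.

Lemma pbij_invK (A B : rngType) (f : pbij A B) b :
  pcod f b -> f (pbij_inv f b) = b.
Proof.
by move=> fb; have [_ _ fs] := pfun_bij f; apply: (surjpK _ fs); rewrite inE.
Qed.

Lemma pbij_inv_dom (A B : rngType) (f : pbij A B) b :
  pcod f b -> pdom f (pbij_inv f b).
Proof. by have [+ _ _] := pfun_bij (pbij_inv f); apply. Qed.

Lemma pbij_fK (A B : rngType) (f : pbij A B) a :
  pdom f a -> pbij_inv f (f a) = a.
Proof.
move=> fa; have fb : pcod f (f a) by rewrite -pbij_image; exists a.
by apply: (pbij_inj (pbij_inv_dom fb) fa); rewrite pbij_invK.
Qed.

(** This preimage is both the domain of a composite and the set in (P3) and (P4); as a condition at
    the source it can be handled without [pbij_inv]. *)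
Lemma pbij_inv_image (A B : rngType) (f : pbij A B) (D : set B) :
  pbij_inv f @` (D `&` pcod f) = [set a | pdom f a /\ D (f a)].
Proof.
apply/seteqP; split=> [_ [b [Db fb] <-]|a [fa Da]] /=.
  by split; [apply: pbij_inv_dom | rewrite pbij_invK].
exists (f a); last exact: pbij_fK.
by split=> //; rewrite -pbij_image; exists a.
Qed.

Lemma pdom_comp (A B C : rngType) (f' : pbij B C) (f : pbij A B) :
  pdom (pbij_comp f' f) = [set a | pdom f a /\ pdom f' (f a)].
Proof. exact: pbij_inv_image. Qed.

Lemma pbij_compE (A B C : rngType) (f' : pbij B C) (f : pbij A B) a :
  pbij_comp f' f a = f' (f a).
Proof. by []. Qed.

Lemma pcod_comp (A B C : rngType) (f' : pbij B C) (f : pbij A B) :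
  pcod (pbij_comp f' f) = f' @` (pdom f' `&` pcod f).
Proof. by []. Qed.

(** * The functor from [G] to its isotropy group at [x] *)

Lemma ginv_unique (G : groupoid) (y z : G) (g : hom y z) (h : hom z y) :
  gcomp h g = gid y -> h = ginv g.
Proof. by move=> hg; rewrite -[h]gcompr1 -(gcomprV g) gcompA hg gcomp1. Qed.

Section Isotropy.
Context (G : groupoid) (x : G) (tau : transversal_for x).

Lemma to_isotropy_id (y : G) : to_isotropy tau (gid y) = gid x.
Proof. by rewrite /to_isotropy gcomp1 gcompV. Qed.

Lemma to_isotropy_comp (y z w : G) (g : hom z w) (h : hom y z) :
  to_isotropy tau (gcomp g h) = gcomp (to_isotropy tau g) (to_isotropy tau h).
Proof.
by rewrite /to_isotropy -!gcompA (gcompA (tau z)) gcomprV gcomp1.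
Qed.

Lemma to_isotropy_inv (y z : G) (g : hom y z) :
  to_isotropy tau (ginv g) = ginv (to_isotropy tau g).
Proof.
by apply: ginv_unique; rewrite -to_isotropy_comp gcompV to_isotropy_id.
Qed.

(** Conjugation by [tau z] is a section of g ↦ g_x over the loops at [z]; it supplies the morphisms
    required in (G4). *)
Lemma to_isotropy_lift (z : G) (k : hom x x) :
  to_isotropy tau (gcomp (tau z) (gcomp k (ginv (tau z)))) = k.
Proof.
by rewrite /to_isotropy -!gcompA gcompV gcompr1 gcompA gcompV gcomp1.
Qed.

End Isotropy.

(** * Transport of a group action along a family of isomorphisms *)

Section Transport.
Context (G : groupoid) (x : G) (tau : transversal_for x) (A : rngType).
Implicit Types (X R : set A) (I : G -> set A) (f : G -> pbij A A)
  (alpha : hom x x -> pbij A A) (beta : pfamily G A).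

(** Phrased on points [f y a] rather than as equality with [conj_family], so that it also covers
    [Ext], which is prescribed separately at identities, and no inverse of [f y] appears. *)
Definition is_transport f alpha beta : Prop :=
  forall (y z : G) (g : hom y z),
    [/\ pdom (beta y z g) = f y @` pdom (alpha (to_isotropy tau g)),
        pcod (beta y z g) = f z @` pcod (alpha (to_isotropy tau g)) &
        forall a, pdom (alpha (to_isotropy tau g)) a ->
          beta y z g (f y a) = f z (alpha (to_isotropy tau g) a)].

(** The shape common to (C1) and (C3), with [X] standing for I_x or J_x. *)
Definition is_iso_family X I f : Prop :=
  forall y : G, [/\ pdom (f y) = X, pcod (f y) = I y & is_ring_iso (f y)].

Lemma group_action_P1 X alpha (h : hom x x) :
  is_partial_group_action X alpha ->
  [/\ is_ideal X (pcod (alpha h)), is_ideal X (pdom (alpha h)),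
      pdom (alpha h) = pcod (alpha (ginv h)) & is_ring_iso (alpha h)].
Proof.
case=> aP aX; have codX k : is_ideal X (pcod (alpha k)).
  by have [_ + _ _] := pa_P1 aP (y := tt) (z := tt) k; rewrite /obcarrier /carrier aX.
have [_ _ domE aI] := pa_P1 aP (y := tt) (z := tt) h.
by split=> //; rewrite [pdom _]domE; apply: codX.
Qed.

(** Domain and range of each [alpha k] lie in [X], the full domain of every [f y], so the
    intersections in the two compositions cut nothing away. *)
Lemma is_transport_conj X I f alpha :
  is_partial_group_action X alpha -> is_iso_family X I f ->
  is_transport f alpha (conj_family tau f alpha).
Proof.
move=> aP fP y z g; rewrite /conj_family; set k := to_isotropy tau g.
have [[codX _ _ _] [domX _ _ _] _ _] := group_action_P1 k aP.
have [fyX fyI _] := fP y; have [fzX fzI _] := fP z.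
have ak_cod a : pdom (alpha k) a -> pcod (alpha k) (alpha k a).
  by move=> ka; rewrite -pbij_image; exists a.
split.
- rewrite !pdom_comp; apply/seteqP; split=> [b [[fb kb] _]|_ [a ka <-]].
    by exists (pbij_inv (f y) b) => //; apply: pbij_invK.
  have fa : pdom (f y) a by rewrite fyX; apply: domX.
  rewrite /mkset pbij_compE pbij_fK //.
  split; last by rewrite fzX; apply/codX/ak_cod.
  by split=> //; change (pcod (f y) (f y a)); rewrite -pbij_image; exists a.
- rewrite !pcod_comp; congr image; apply/seteqP; split=> [_ [_ [a [ka _] <-]]|b kb].
    exact: ak_cod.
  split; first by rewrite fzX; apply: codX.
  move: kb; rewrite -pbij_image => -[a ka <-]; exists a => //; split=> //.
  by change (pdom (f y) a); rewrite fyX; apply: domX.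
- by move=> a ka; rewrite !pbij_compE pbij_fK // fyX; apply: domX.
Qed.

Lemma transport_obcarrier X I f alpha beta (y : G) :
  is_partial_group_action X alpha -> is_iso_family X I f ->
  is_transport f alpha beta -> obcarrier beta y = I y.
Proof.
move=> [_ aX] fP /(_ y y (gid y))[_ bE _]; have [fyX fyI _] := fP y.
by rewrite /obcarrier /carrier bE to_isotropy_id aX -fyX pbij_image.
Qed.

(* The hypotheses on [a] say that it lies in the left-hand side of (P3). *)
Lemma group_action_comp X alpha (g h : hom x x) a :
  is_partial_group_action X alpha ->
  pdom (alpha h) a -> pdom (alpha g) (alpha h a) ->
  pdom (alpha (gcomp g h)) a /\ alpha g (alpha h a) = alpha (gcomp g h) a.
Proof.
move=> aP ha ga; have [aA _] := aP.
have in3 : (pbij_inv (alpha h) @` (pcod (alpha (ginv g)) `&` pcod (alpha h))) a.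
  rewrite pbij_inv_image; split=> //.
  by have [_ _ <- _] := group_action_P1 g aP.
have [_ _ -> _] := group_action_P1 (gcomp g h) aP; split.
  exact: (pa_P3 aA (y := tt) (z := tt) (w := tt) (g := g) (h := h)).
exact: (pa_P4 aA (y := tt) (z := tt) (w := tt) (g := g) (h := h)).
Qed.

(** With [b = f y a], injectivity of [f z] on [X] turns definedness of the composite at [b] into
    definedness for [alpha] at [a]; functoriality of g ↦ g_x then brings the group case back. *)
Lemma transport_comp X I f alpha beta (y z w : G) (g : hom z w) (h : hom y z) b :
  is_partial_group_action X alpha -> is_iso_family X I f ->
  is_transport f alpha beta ->
  pdom (beta y z h) b -> pdom (beta z w g) (beta y z h b) ->
  pdom (beta y w (gcomp g h)) b /\
  beta z w g (beta y z h b) = beta y w (gcomp g h) b.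
Proof.
move=> aP fP bT; have [hD _ hE] := bT _ _ h; have [gD _ gE] := bT _ _ g.
have [ghD _ ghE] := bT _ _ (gcomp g h).
rewrite hD => -[a ha <-]; rewrite hE // gD => -[c gc /esym cE].
have [[hcX _ _ _] _ _ _] := group_action_P1 (to_isotropy tau h) aP.
have [_ [gdX _ _ _] _ _] := group_action_P1 (to_isotropy tau g) aP.
have [fzX _ _] := fP z.
have {}cE : c = alpha (to_isotropy tau h) a.
  apply: (pbij_inj (f := f z)); rewrite ?fzX //; first exact: gdX.
  by apply: hcX; rewrite -pbij_image; exists a.
rewrite {}cE in gc; rewrite gE //.
have [gha ->] := group_action_comp aP ha gc.
by rewrite ghD; move: gha ghE; rewrite to_isotropy_comp => gha ->.
Qed.

Lemma transport_partial_action X R I f alpha beta :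
  is_subring R -> (forall y, is_ideal R (I y)) ->
  is_partial_group_action X alpha -> is_iso_family X I f ->
  is_transport f alpha beta -> is_partial_action R beta.
Proof.
move=> Rr IR aP fP bT; have [aA aX] := aP; have Xr := pa_ring aA.
have obE y : obcarrier beta y = I y by apply: transport_obcarrier aP fP bT.
have domE y z (g : hom y z) : pdom (beta y z g) = carrier beta (ginv g).
  have [-> _ _] := bT _ _ g; rewrite /carrier; have [_ -> _] := bT _ _ (ginv g).
  rewrite to_isotropy_inv.
  by have [_ _ -> _] := group_action_P1 (to_isotropy tau g) aP.
(* The elements concerned by (P3) and (P4) are those where [h] and then [g] act, so [transport_comp]
   settles both axioms. *)
have P3E y z w (g : hom z w) (h : hom y z) :
    pbij_inv (beta y z h) @` (carrier beta (ginv g) `&` carrier beta h) =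
    [set a | pdom (beta y z h) a /\ pdom (beta z w g) (beta y z h a)].
  by rewrite pbij_inv_image -domE.
split=> //.
- move=> y z g; rewrite obE.
  have [fyX fyI fyH] := fP y; have [fzX fzI fzH] := fP z.
  have [bD bC bE] := bT _ _ g.
  have [cI dI _ aH] := group_action_P1 (to_isotropy tau g) aP.
  split=> //.
  + rewrite /carrier bC -fzI -pbij_image fzX; apply: is_ideal_image => //.
    by rewrite -fzX.
  + move=> u v; rewrite bD => -[a aa <-] [b ab <-].
    have [dX _ _ dM] := dI; have [cX _ _ _] := cI.
    have aC c : pdom (alpha (to_isotropy tau g)) c ->
        X (alpha (to_isotropy tau g) c).
      by move=> ?; apply: cX; rewrite -pbij_image; exists c.
    have fyXH := fyH; have fzXH := fzH.
    rewrite /is_ring_iso fyX in fyXH; rewrite /is_ring_iso fzX in fzXH.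
    have [<- <-] := fyXH a b (dX _ aa) (dX _ ab).
    (* Sum and product stay in the domain of [alpha], an ideal of [X], so the transport formula
       applies to them too. *)
    have Mab := (dM a b (dX _ aa) ab).1; have Dab := is_idealD dI aa ab.
    rewrite !bE //; have [-> ->] := aH a b aa ab.
    exact: fzXH (aC _ aa) (aC _ ab).
- move=> y; have [bD _ bE] := bT _ _ (gid y); have [fyX fyI _] := fP y.
  have [aD aid] : pdom (alpha (gid x)) = X /\
      forall a, pdom (alpha (gid x)) a -> alpha (gid x) a = a.
    by have [-> _ aid] := pa_P2 aA tt.
  have idD : pdom (beta y y (gid y)) = I y.
    by rewrite bD to_isotropy_id aD -fyX pbij_image.
  rewrite obE; split; rewrite ?idD //; first exact: obE.
  move=> b; rewrite -fyI -pbij_image fyX => -[a Xa <-].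
  by move: bE; rewrite to_isotropy_id => ->; rewrite ?aid ?aD.
- move=> y z w g h a; rewrite P3E -domE => -[ha ga].
  by have [] := transport_comp aP fP bT ha ga.
- move=> y z w g h a; rewrite P3E => -[ha ga].
  by have [] := transport_comp aP fP bT ha ga.
Qed.

(** Globality makes [alpha h] after [alpha (ginv h)] the map at the identity, whose range is [X];
    the range of a composite lies in that of its outer factor, so [alpha h] is onto [X]. Domains are
    ranges of inverses. *)
Lemma global_group_action_full X alpha (h : hom x x) :
  is_partial_group_action X alpha ->
  is_global_action X (isotropy_family alpha) ->
  pdom (alpha h) = X /\ pcod (alpha h) = X.
Proof.
move=> aP aG; have full k : pcod (alpha k) = X.
  have [[kX _ _ _] _ _ _] := group_action_P1 k aP.
  apply/seteqP; split=> // a; have [_ <-] := aP.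
  have [_ + _] := ga_comp aG (y := tt) (z := tt) (w := tt) k (ginv k).
  rewrite /isotropy_family /= gcomprV => <- [b [kb _] <-].
  by rewrite -pbij_image; exists b.
by have [_ _ -> _] := group_action_P1 h aP; rewrite !full.
Qed.

Lemma transport_global_full X I f alpha beta (y z : G) (g : hom y z) :
  is_partial_group_action X alpha ->
  is_global_action X (isotropy_family alpha) -> is_iso_family X I f ->
  is_transport f alpha beta ->
  pdom (beta y z g) = I y /\ pcod (beta y z g) = I z.
Proof.
move=> aP aG fP /(_ _ _ g)[-> -> _].
have [-> ->] := global_group_action_full (to_isotropy tau g) aP aG.
have [fyX fyI _] := fP y; have [fzX fzI _] := fP z.
by rewrite -{1}fyX -fzX !pbij_image.
Qed.

Lemma transport_global_action X R I f alpha beta :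
  is_subring R -> (forall y, is_ideal R (I y)) ->
  is_partial_group_action X alpha ->
  is_global_action X (isotropy_family alpha) -> is_iso_family X I f ->
  is_transport f alpha beta -> is_global_action R beta.
Proof.
move=> Rr IR aP aG fP bT; split; first exact: transport_partial_action IR aP fP bT.
move=> y z w g h.
have full u v (k : hom u v) : pdom (beta u v k) = I u /\ pcod (beta u v k) = I v.
  exact: transport_global_full aP aG fP bT.
have hI b : I y b -> I z (beta y z h b).
  by have [<- <-] := full _ _ h => hb; rewrite -pbij_image; exists b.
have domE : pdom (pbij_comp (beta z w g) (beta y z h)) = I y.
  rewrite pdom_comp (full _ _ g).1 (full _ _ h).1.
  by apply/seteqP; split=> [b []|b Ib] //; split=> //; apply: hI.
split.
- by rewrite domE (full _ _ _).1.
- by rewrite pcod_comp (full _ _ g).1 (full _ _ h).2 setIid -(full _ _ g).1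
    pbij_image !(full _ _ _).2.
- move=> b; rewrite domE => Ib.
  by apply: (transport_comp aP fP bT _ _).2; rewrite (full _ _ _).1 //; apply: hI.
Qed.

End Transport.

(** * Globalization of transported actions *)

Lemma is_transport_Ext (G : groupoid) (x : G) (tau : transversal_for x)
    (A : rngType) (gamma : dobject tau A) :
  is_iso_family (d_ideal gamma x) (d_ideal gamma) (d_tau gamma) ->
  is_transport tau (d_tau gamma) (d_iso gamma) (Ext gamma).
Proof.
move=> fP y z g; rewrite /Ext; have aP := d_isoP gamma.
(* At an identity, (P2) makes the group map the identity of I_x, and its transport along
   [d_tau gamma y] is the identity of I_y, which is the prescribed value. *)
case: pselect => [idg|nid] /=; last exact: (is_transport_conj tau aP fP).
case: y z g / idg => y; rewrite to_isotropy_id /=.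
have [aA aX] := aP; have [fyX fyI _] := fP y.
have [] := pa_P2 aA tt; rewrite /isotropy_family /obcarrier /carrier /= aX.
move=> -> _ aid; split; try by rewrite -fyX pbij_image.
by move=> a Xa; rewrite aid.
Qed.

(** Besides transport of the action axioms, two facts enter: injectivity of [f' z] on [Y], for the
    intersection in (G2), and liftability of loops at [x] to loops at [z], for the sum in (G4). *)
Lemma transport_globalization (G : groupoid) (x : G) (tau : transversal_for x)
    (A B : rngType) (R X : set A) (I : G -> set A) (f : G -> pbij A A)
    (alpha : hom x x -> pbij A A) (theta : pfamily G A)
    (S Y : set B) (J : G -> set B) (f' : G -> pbij B B)
    (alpha' : hom x x -> pbij B B) (beta : pfamily G B) (iota : G -> A -> B) :
  is_subring R -> (forall y, is_ideal R (I y)) -> is_iso_family X I f ->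
  is_transport tau f alpha theta ->
  is_subring S -> (forall y, is_ideal S (J y)) -> is_iso_family Y J f' ->
  is_transport tau f' alpha' beta ->
  is_group_globalization X alpha Y alpha' (iota x) ->
  (forall y, is_embedding (I y) (iota y)) ->
  (forall y, is_ideal (J y) (iota y @` I y)) ->
  (forall y a, X a -> f' y (iota x a) = iota y (f y a)) ->
  is_globalization R theta S beta iota.
Proof.
move=> Rr IR fP tT Sr JS f'P bT glob emb iotaI ext.
have [aP a'P gg] := glob; have a'G := gl_global gg.
have obtE y : obcarrier theta y = I y by apply: transport_obcarrier aP fP tT.
have obbE y : obcarrier beta y = J y by apply: transport_obcarrier a'P f'P bT.
have thetaP := transport_partial_action Rr IR aP fP tT.
have fI y : f y @` X = I y by have [<- <- _] := fP y; rewrite pbij_image.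
have f'J y : f' y @` Y = J y by have [<- <- _] := f'P y; rewrite pbij_image.
have obX : obcarrier (isotropy_family alpha) tt = X by case: aP.
have obY : obcarrier (isotropy_family alpha') tt = Y by case: a'P.
have iotaXY a : X a -> Y (iota x a).
  have [+ _ _ _] := gl_G1 gg tt; rewrite obX obY => sub Xa.
  by apply: sub; exists a.
have a'D k : pdom (alpha' k) = Y by have [] := global_group_action_full k a'P a'G.
have a'C k : pcod (alpha' k) = Y by have [] := global_group_action_full k a'P a'G.
(* Since [f' y] extends [f y] along [iota], the argument is [f' y (iota x a)], where the transport
   formula for [beta] applies. *)
have betaE (y z : G) (g : hom y z) a : X a ->
    beta y z g (iota y (f y a)) = f' z (alpha' (to_isotropy tau g) (iota x a)).
  move=> Xa; have [_ _ bE] := bT _ _ g.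
  by rewrite -ext // bE // a'D; apply: iotaXY.
have Yr : is_subring Y by case: a'P => /pa_ring.
have f'H y : is_ring_hom Y (f' y) by have [<- _] := f'P y.
have iota_img z : iota z @` I z = f' z @` (iota x @` X).
  rewrite -fI; apply/seteqP; split=> _ [_ [a Xa <-] <-].
    by rewrite -ext //; do 2 eexists=> //.
  by rewrite ext //; do 2 eexists=> //.
have beta_img (y z : G) (g : hom y z) : beta y z g @` (iota y @` obcarrier theta y) =
    f' z @` (alpha' (to_isotropy tau g) @` (iota x @` X)).
  rewrite obtE -fI; apply/seteqP; split=> [_ [_ [_ [a Xa <-] <-] <-]|_ [_ [_ [a Xa <-] <-] <-]].
    by rewrite betaE //; do 3 eexists=> //.
  by rewrite -betaE //; do 3 eexists=> //.
have a'img k : alpha' k @` (iota x @` X) `<=` Y.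
  move=> _ [_ [a Xa <-] <-]; rewrite -(a'C k) -pbij_image a'D.
  by exists (iota x a) => //; apply: iotaXY.
split.
- exact: thetaP.
- exact: transport_global_action JS a'P a'G f'P bT.
- by move=> y; rewrite obtE.
- by move=> y; rewrite obtE obbE.
- move=> y z g; rewrite beta_img obtE iota_img.
  have := gl_G2 gg (y := tt) (z := tt) (to_isotropy tau g).
  rewrite obX /carrier /isotropy_family => G2.
  have [_ -> _] := tT _ _ g.
  have [[codX _ _ _] _ _ _] := group_action_P1 (to_isotropy tau g) aP.
  transitivity (f' z @` (iota x @` pcod (alpha (to_isotropy tau g)))).
    by apply/seteqP; split=> _ [_ [a ka <-] <-]; [rewrite -ext | rewrite ext];
      try exact: codX; do 2 eexists=> //.
  rewrite G2; apply/seteqP; split=> [_ [b [bX bk] <-]|c [[b bX <-] [d dk E]]].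
    by split; exists b.
  (* Both sets intersected in (G2) for the group lie in [Y], where [f' z] is injective, so images
     commute with this intersection. *)
  have {}E : d = b.
    have [f'Y _ _] := f'P z; apply: (pbij_inj (f := f' z)); rewrite ?f'Y //.
      exact: a'img dk.
    by case: bX => a Xa <-; apply: iotaXY.
  by exists b => //; split=> //; rewrite -E.
(* (G3): writing [a = f y c], both sides become [f' z] of a value at [c], and (G3) for the group
   identifies these values. *)
- move=> y z g a; have [_ _ <- _] := pa_P1 thetaP g.
  have [-> _ tE] := tT _ _ g; move=> [c kc <-].
  have [[kX _ _ _] [dX _ _ _] dE _] := group_action_P1 (to_isotropy tau g) aP.
  rewrite betaE ?tE //; last exact: dX.
  have G3 := gl_G3 gg (y := tt) (z := tt) (g := to_isotropy tau g) (a := c).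
  rewrite [alpha' _ _]G3; last by rewrite /carrier /isotropy_family /= -dE.
  by apply: ext; apply: kX; rewrite -pbij_image; exists c.
- move=> y z g.
  have -> : carrier beta g = J z.
    by have [] := transport_global_full g a'P a'G f'P bT.
  apply/seteqP; split.
    rewrite -f'J => _ [b Yb <-].
    have := gl_G4 gg (@gid (isotropy x) tt).
    rewrite -[carrier _ _]/(obcarrier (isotropy_family alpha') tt) obY => G4.
    move: Yb; rewrite G4 => -[n [k [c [kc ->]]]].
    (* Each summand at the loop [k i] is pushed forward by [f' z] and indexed by the conjugate of
       [k i] by [tau z], so every source object is [z]. *)
    exists n.
    exists (fun i => existT (fun w => hom w z) z
      (gcomp (tau z) (gcomp (projT2 (k i) : hom x x) (ginv (tau z))))).
    exists (fun i => f' z (c i)); split.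
      move=> i; rewrite beta_img to_isotropy_lift.
      by exists (c i) => //; have := kc i; case: (k i) => -[] ki; rewrite obX.
    apply: (ring_hom_sum Yr) => // i.
    by have := kc i; case: (k i) => -[] ki; rewrite obX; apply: a'img.
  (* Conversely each summand is [f' z] of an element of [Y], hence in the ideal [J z], which is
     closed under finite sums. *)
  move=> _ [n [k [c [kc ->]]]].
  have [_ J0 _ _] := JS z; apply: (big_ind (J z)) => //.
    by move=> u v; apply: is_idealD (JS z).
  move=> i _; have := kc i; rewrite beta_img -f'J => -[b bk <-].
  by exists b => //; apply: a'img bk.
Qed.

Theorem proposition4p2 (G : groupoid) (x : G) (tau : transversal_for x)
  (A : rngType) (gamma : dobject tau A)
  (B : rngType) (J : G -> set B) (iota : G -> A -> B)
  (gt_iso : hom x x -> pbij B B) (gt_tau : G -> pbij B B)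
  (G_connected : connected G)
  (C1 : forall y : G, pdom (d_tau gamma y) = d_ideal gamma x /\
                      pcod (d_tau gamma y) = d_ideal gamma y)
  (C2_unital : is_unital (d_ideal gamma x))
  (C2_glob : is_group_globalization (d_ideal gamma x) (d_iso gamma)
               (J x) gt_iso (iota x))
  (C3_J : forall y : G, is_ideal [set: B] (J y))
  (C3_iso : forall y : G, [/\ pdom (gt_tau y) = J x, pcod (gt_tau y) = J y
                            & is_ring_iso (gt_tau y)])
  (C3_emb : forall y : G, is_embedding (d_ideal gamma y) (iota y))
  (C3_ideal : forall y : G, is_ideal (J y) (iota y @` d_ideal gamma y))
  (C3_ext : forall (y : G) (a : A), d_ideal gamma x a ->
              gt_tau y (iota x a) = iota y (d_tau gamma y a)) :
  let beta := conj_family tau gt_tau gt_iso in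
  (forall (y z : G) (g : hom y z),
     pdom (beta y z g) = J y /\ pcod (beta y z g) = J z) /\
  is_globalization [set: A] (Ext gamma) [set: B] beta iota.
Proof.
move=> beta; have [_ a'P gg] := C2_glob.
have fP : is_iso_family (d_ideal gamma x) (d_ideal gamma) (d_tau gamma).
  by move=> y; have [? ?] := C1 y; split=> //; apply: d_tau_iso.
have bT : is_transport tau gt_tau gt_iso beta by apply: is_transport_conj a'P C3_iso.
split=> [y z g|].
  exact: transport_global_full a'P (gl_global gg) C3_iso bT.
exact: (transport_globalization (is_subring_setT A) (d_idealP gamma) fP
  (is_transport_Ext fP) (is_subring_setT B) C3_J C3_iso bT C2_glob).
Qed.
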